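(* For every integer $k\ge3$, the following identity of formal power series in $q$ holds: $$\sum_{n=0}^{\infty}RD_3^{3,27}\left(3^kn+\frac{3^k+13}{2}\right)q^n=\sum_{i=1}^{\frac{3^{k-3}\cdot13+1}{2}}y_{k,i}\,q^{i-1}\frac{E_3^{3(4i-2)}}{E_1^{3(4i-2)}},$$ where the coefficient vectors $y_k=(y_{k,1},y_{k,2},\ldots)$ are given by $$y_1=(9,0,0,0,\ldots),\qquad y_2=(3^2,\,3^7,\,3^{10},\,0,\,0,\ldots),\qquad y_3=y_2\cdot B,$$ with $B=(b_{i,j})_{i,j\ge1}$ defined by $b_{i,j}=m_{4i-3,\,i+j-1}$, and, for $k\ge3$, $y_{k+1}=y_k\cdot A$ with $A=(a_{i,j})_{i,j\ge1}$ defined by $a_{i,j}=m_{4i-2,\,i+j-1}$ (products are row vector times infinite matrix). Here $M=(m_{i,j})_{i,j\ge1}$ is the integer matrix defined in the context.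
   Context: For $r\ge1$, $E_r=\prod_{n=1}^{\infty}(1-q^{nr})$, $|q|<1$ (or as a formal power series in $q$). For positive integers $\ell,t,k$, $RD_k^{\ell,t}(n)$ denotes the number of partitions of $n$ in which each part carries one of $k$ colors, no part is divisible by $\ell$, and each colored part appears fewer than $t$ times; its generating function is $$\sum_{n=0}^{\infty}RD_k^{\ell,t}(n)q^n=\left(\frac{E_\ell E_t}{E_1E_{\ell t}}\right)^k.$$ In particular $\sum_{n\ge0}RD_3^{3,27}(n)q^n=\left(\frac{E_3E_{27}}{E_1E_{81}}\right)^3$. The matrix $M$: let $H_3$ be the operator on formal Laurent series in $q$ given by $H_3\left(\sum_n a(n)q^n\right)=\sum_n a(3n)q^{3n}$, and put $$\zeta=\frac{E_1^3}{qE_9^3},\qquad T=\frac{E_3^{12}}{q^3E_9^{12}}.$$ The numbers $m_{i,j}$ are defined by the expansions $H_3\left(\zeta^{-i}\right)=\sum_{j=1}^{i}m_{i,j}T^{-j}$ for $i\ge1$, with $m_{i,j}=0$ for $j>i$. Explicitly, the first three rows of $M$ are $(9,0,0,0,\ldots)$, $(6,243,0,0,\ldots)$, $(1,243,6561,0,\ldots)$, and for $i\ge4$ one has $m_{i,1}=0$ and $m_{i,j}=27m_{i-1,j-1}+9m_{i-2,j-1}+m_{i-3,j-1}$ for $j\ge2$. *)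

(* Defs.v *)
From HB Require Import structures.
From mathcomp Require Import all_boot all_order all_algebra finmap.
From mathcomp Require Import boolp classical_sets fsbigop.

Set Implicit Arguments.
Unset Strict Implicit.
Unset Printing Implicit Defensive.

Import Order.TTheory GRing.Theory Num.Theory.

Local Open Scope ring_scope.

(* A record rather than a bare function type, because [nat -> R] already carries
   the pointwise ring structure. *)
Record fps (R : Type) := Fps { fcoef : nat -> R }.

Lemma fpsP (R : Type) (f g : fps R) : (forall n, fcoef f n = fcoef g n) -> f = g.
Proof. by case: f g => f [g] /= e; congr Fps; apply: funext. Qed.

HB.instance Definition _ (R : Type) := gen_eqMixin (fps R).
HB.instance Definition _ (R : Type) := gen_choiceMixin (fps R).

Section FpsRing.
Variable R : comUnitRingType.
Implicit Types f g h : fps R.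

Definition fps_zero : fps R := Fps (fun=> 0).
Definition fps_one : fps R := Fps (fun n => (n == 0)%:R).
Definition fps_opp f := Fps (fun n => - fcoef f n).
Definition fps_add f g := Fps (fun n => fcoef f n + fcoef g n).
Definition fps_mul f g :=
  Fps (fun n => \sum_(i < n.+1) fcoef f i * fcoef g (n - i)).

Definition fps_trunc N f : {poly R} := \poly_(i < N) fcoef f i.

Lemma fps_mulE N f g n : (n < N)%N ->
  fcoef (fps_mul f g) n = (fps_trunc N f * fps_trunc N g)`_n.
Proof.
move=> ltnN; rewrite coefM /=; apply: eq_bigr => i _.
by rewrite !coef_poly !(leq_ltn_trans _ ltnN) ?leq_subr // -ltnS.
Qed.

Lemma fps_coefM_trunc N f (p : {poly R}) n : (n < N)%N ->
  (fps_trunc N f * p)`_n = \sum_(i < n.+1) fcoef f i * p`_(n - i).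
Proof.
move=> ltnN; rewrite coefM; apply: eq_bigr => i _.
by rewrite coef_poly (leq_ltn_trans _ ltnN) // -ltnS.
Qed.

Lemma fps_addA : associative fps_add.
Proof. by move=> f g h; apply: fpsP => n /=; rewrite addrA. Qed.
Lemma fps_addC : commutative fps_add.
Proof. by move=> f g; apply: fpsP => n /=; rewrite addrC. Qed.
Lemma fps_add0 : left_id fps_zero fps_add.
Proof. by move=> f; apply: fpsP => n /=; rewrite add0r. Qed.
Lemma fps_addN : left_inverse fps_zero fps_opp fps_add.
Proof. by move=> f; apply: fpsP => n /=; rewrite addNr. Qed.

HB.instance Definition _ :=
  GRing.isZmodule.Build (fps R) fps_addA fps_addC fps_add0 fps_addN.

Lemma fps_mulC : commutative fps_mul.
Proof.
by move=> f g; apply: fpsP => n; rewrite !(@fps_mulE n.+1) // mulrC.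
Qed.

Lemma fps_mulA : associative fps_mul.
Proof.
move=> f g h; apply: fpsP => n.
have aux (a b c : fps R) : fcoef (fps_mul a (fps_mul b c)) n =
    (fps_trunc n.+1 a * (fps_trunc n.+1 b * fps_trunc n.+1 c))`_n.
  rewrite fps_coefM_trunc //=; apply: eq_bigr => i _; congr (_ * _).
  by rewrite -fps_mulE ?ltnS ?leq_subr.
by rewrite aux (fps_mulC (fps_mul f g)) aux; congr (_`_n); rewrite mulrA mulrC.
Qed.

Lemma fps_mul1 : left_id fps_one fps_mul.
Proof.
move=> f; apply: fpsP => n /=.
rewrite big_ord_recl /= mul1r subn0 big1 ?addr0 // => i _.
by rewrite mul0r.
Qed.

Lemma fps_mulDl : left_distributive fps_mul fps_add.
Proof.
move=> f g h; apply: fpsP => n /=; rewrite -big_split /=.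
by apply: eq_bigr => i _; rewrite mulrDl.
Qed.

Lemma fps_oner_neq0 : fps_one != 0.
Proof.
by apply/eqP => /(congr1 (fun f => fcoef f 0)) /= /eqP; rewrite oner_eq0.
Qed.

HB.instance Definition _ := GRing.Zmodule_isComNzRing.Build (fps R)
  fps_mulA fps_mulC fps_mul1 fps_mulDl fps_oner_neq0.

Lemma fcoef0 n : fcoef (0 : fps R) n = 0. Proof. by []. Qed.
Lemma fcoef1 n : fcoef (1 : fps R) n = (n == 0)%:R. Proof. by []. Qed.
Lemma fcoefN f n : fcoef (- f) n = - fcoef f n. Proof. by []. Qed.
Lemma fcoefD f g n : fcoef (f + g) n = fcoef f n + fcoef g n.
Proof. by []. Qed.
Lemma fcoefM f g n :
  fcoef (f * g) n = \sum_(i < n.+1) fcoef f i * fcoef g (n - i).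
Proof. by []. Qed.

(* The first n+1 coefficients of the inverse, latest first. *)
Fixpoint fps_inv_rev f (n : nat) : seq R :=
  if n is n'.+1 then
    let s := fps_inv_rev f n' in
    - (fcoef f 0)^-1 * (\sum_(i < n) fcoef f i.+1 * s`_i) :: s
  else [:: (fcoef f 0)^-1].

Definition fps_unit : {pred fps R} := fun f => fcoef f 0 \is a GRing.unit.

Definition fps_inv f : fps R :=
  if f \in fps_unit then Fps (fun n => (fps_inv_rev f n)`_0) else f.

Lemma fps_inv_revE f n i : (i <= n)%N ->
  (fps_inv_rev f n)`_i = (fps_inv_rev f (n - i))`_0.
Proof.
by elim: n i => [|n IHn] [|i] //=; rewrite ltnS => /IHn ->; rewrite subSS.
Qed.

Lemma fps_mulV : {in fps_unit, left_inverse 1 fps_inv *%R}.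
Proof.
move=> f Uf; rewrite mulrC; apply: fpsP => n.
rewrite fcoefM /fps_inv Uf fcoef1 /=.
case: n => [|n]; rewrite big_ord_recl subn0 /=.
  by rewrite big_ord0 addr0 divrr.
rewrite mulrA mulrN divrr // mulN1r; apply/eqP; rewrite addrC subr_eq0; apply/eqP.
apply: eq_bigr => i _.
by rewrite subSS -fps_inv_revE // -ltnS.
Qed.

Lemma fps_unitPl f g : g * f = 1 -> f \in fps_unit.
Proof.
move=> /(congr1 (fun h => fcoef h 0)); rewrite fcoefM big_ord_recl big_ord0 addr0.
rewrite fcoef1 /= => e; apply/unitrPr; exists (fcoef g 0).
by rewrite mulrC.
Qed.

Lemma fps_inv_out : {in [predC fps_unit], fps_inv =1 id}.
Proof. by move=> f; rewrite inE /= /fps_inv => /negbTE ->. Qed.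

HB.instance Definition _ := GRing.ComNzRing_hasMulInverse.Build (fps R)
  fps_mulV fps_unitPl fps_inv_out.

Lemma fps_unitE f : (f \is a GRing.unit) = (fcoef f 0 \is a GRing.unit).
Proof. by []. Qed.

End FpsRing.

Definition q : fps int := Fps (fun n => (n == 1)%:R).

(* For r >= 1 the coefficient of q^n in the partial products of
   prod_(m >= 1) (1 - q^(m r)) no longer changes once m >= n; see [EP]. *)
Definition E (r : nat) : fps int :=
  Fps (fun n => fcoef (\prod_(1 <= m < n.+1) (1 - q ^+ (m * r))) n).

(* The colored part of size p.1.+1 and color p.2 occurs f p times. *)
Definition RD (k l t n : nat) : nat :=
  (#|[set f : {ffun 'I_n * 'I_k -> 'I_n.+1} |
       [&& \sum_(p : 'I_n * 'I_k) p.1.+1 * f p == n,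
           [forall p : 'I_n * 'I_k, (l %| p.1.+1) ==> (f p == 0 :> nat)]
         & [forall p, f p < t]]]|)%N.

Definition H3 (f : fps int) : fps int :=
  Fps (fun n => if (3 %| n)%N then fcoef f n else 0).

(* The inverses of zeta = E_1^3 / (q E_9^3) and T = E_3^12 / (q^3 E_9^12): only
   negative powers of these Laurent series occur, and they are power series. *)
Definition zetaV : fps int := q * (E 9 ^+ 3 / E 1 ^+ 3).
Definition TV : fps int := q ^+ 3 * (E 9 ^+ 12 / E 3 ^+ 12).

Definition M_row (i : nat) (r : nat -> int) : Prop :=
  (forall j, ~~ (1 <= j <= i)%N -> r j = 0) /\
  H3 (zetaV ^+ i) = \sum_(1 <= j < i.+1) TV ^+ j *~ r j.

(* The row r with M_row i r, unique by [M_row_uniq]. Its existence (with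
   integer entries) is not assumed; [xget] would give the zero row otherwise. *)
Definition M (i j : nat) : int := xget (fun=> 0) [set r | M_row i r]%classic j.

(* Vectors and matrices are indexed from 1; the entries at 0 are never used. *)
Definition vecmx (v : nat -> int) (A : nat -> nat -> int) : nat -> int :=
  fun j => \sum_(i \in [set i | (1 <= i)%N]%classic) v i * A i j.

Definition A (i j : nat) : int := M (4 * i - 2) (i + j - 1).
Definition B (i j : nat) : int := M (4 * i - 3) (i + j - 1).

Definition vec (s : seq int) (i : nat) : int := nth 0 (0 :: s) i.

Fixpoint y (k : nat) : nat -> int :=
  match k with
  | 0 => vec [::]
  | 1 => vec [:: 9]
  | 2 => vec [:: 3 ^+ 2; 3 ^+ 7; 3 ^+ 10]
  | 3 => vecmx (vec [:: 3 ^+ 2; 3 ^+ 7; 3 ^+ 10]) B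
  | k'.+1 => vecmx (y k') A
  end.

Lemma fcoefqM (f : fps int) n :
  fcoef (q * f) n = if n is n'.+1 then fcoef f n' else 0.
Proof.
rewrite fcoefM big_ord_recl mul0r add0r; case: n => [|n]; first by rewrite big_ord0.
rewrite big_ord_recl /= mul1r subSS subn0 big1 ?addr0 // => i _.
by rewrite mul0r.
Qed.

Lemma fcoefqXM (f : fps int) m n :
  fcoef (q ^+ m * f) n = if (m <= n)%N then fcoef f (n - m) else 0.
Proof.
elim: m n => [|m IHm] n; first by rewrite mul1r subn0.
by rewrite exprS -mulrA fcoefqM; case: n => [|n] //; rewrite IHm ltnS subSS.
Qed.

Lemma EP r N n : (0 < r)%N -> (n <= N)%N ->
  fcoef (\prod_(1 <= m < N.+1) (1 - q ^+ (m * r))) n = fcoef (E r) n.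
Proof.
move=> r_gt0 /subnK <-; elim: (N - n)%N => [//|d IHd].
have -> F : \prod_(1 <= m < (d.+1 + n).+1) F m =
    F (d + n).+1 * \prod_(1 <= m < (d + n).+1) F m :> fps int.
  by rewrite addSn big_nat_recr // mulrC.
rewrite mulrBl mul1r fcoefD fcoefN IHd.
rewrite fcoefqXM leqNgt (leq_trans _ (leq_pmulr _ r_gt0)) ?subr0 //.
by rewrite ltnS leq_addl.
Qed.

Lemma E_unit r : E r \is a GRing.unit.
Proof. by rewrite fps_unitE /= big_nil. Qed.

Lemma fcoefMz (f : fps int) (a : int) n : fcoef (f *~ a) n = a * fcoef f n.
Proof.
have aux m : fcoef (f *+ m) n = m%:R * fcoef f n.
  elim: m => [|m IHm]; first by rewrite mulr0n mul0r.
  by rewrite mulrS fcoefD IHm mulrS mulrDl mul1r.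
case: a => m; first by rewrite -pmulrn aux natz.
by rewrite NegzE mulrNz fcoefN -pmulrn aux mulNr natz.
Qed.

Lemma M_row_uniq i r s : M_row i r -> M_row i s -> r = s.
Proof.
move=> [r0 rE] [s0 sE]; apply: funext.
have TVE j : TV ^+ j = q ^+ (3 * j) * (E 9 ^+ 12 / E 3 ^+ 12) ^+ j.
  by rewrite exprMn exprM.
have cTV j n : fcoef (TV ^+ j) n =
    if (3 * j <= n)%N then fcoef ((E 9 ^+ 12 / E 3 ^+ 12) ^+ j) (n - 3 * j) else 0.
  by rewrite TVE fcoefqXM.
have fsum (F : nat -> fps int) n k l : fcoef (\sum_(k <= j < l) F j) n
    = \sum_(k <= j < l) fcoef (F j) n.
  by elim/big_rec2: _ => // j a b _ <-; rewrite fcoefD.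
have U0 j : fcoef ((E 9 ^+ 12 / E 3 ^+ 12) ^+ j) 0 != 0.
  have : (E 9 ^+ 12 / E 3 ^+ 12) ^+ j \is a GRing.unit.
    move: (E 9) (E 3) (E_unit 9) (E_unit 3) => e f Ue Uf.
    by apply: unitrX; rewrite unitrM unitrV; apply/andP; split; apply: unitrX.
  by rewrite fps_unitE; apply: contraL => /eqP ->; rewrite unitr0.
move=> j; elim/ltn_ind: j => j IHj.
have [/andP[j_gt0 lej]|jout] := boolP (1 <= j <= i)%N; last by rewrite r0 ?s0.
have split (u : nat -> int) :
    fcoef (\sum_(1 <= l < i.+1) TV ^+ l *~ u l) (3 * j) =
    \sum_(1 <= l < j) fcoef (TV ^+ l *~ u l) (3 * j) +
      u j * fcoef ((E 9 ^+ 12 / E 3 ^+ 12) ^+ j) 0.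
  rewrite fsum (big_cat_nat _ (n := j)) ?leqW //; congr (_ + _).
  have tail : \sum_(j.+1 <= l < i.+1) fcoef (TV ^+ l *~ u l) (3 * j) = 0.
    rewrite big_nat big1 // => l /andP[ltjl _].
    by rewrite fcoefMz cTV leq_pmul2l // leqNgt ltjl mulr0.
  rewrite (_ : \sum_(j <= l < i.+1) _ = fcoef (TV ^+ j *~ u j) (3 * j) + 0).
    by rewrite addr0 fcoefMz cTV leqnn subnn.
  by rewrite big_ltn //; congr (_ + _).
have := congr1 (fun f => fcoef f (3 * j)) (etrans (esym rE) sE).
rewrite !split.
have -> : \sum_(1 <= l < j) fcoef (TV ^+ l *~ r l) (3 * j) =
          \sum_(1 <= l < j) fcoef (TV ^+ l *~ s l) (3 * j).
  by apply: eq_big_nat => l /andP[_ /IHj ->].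
by move=> /addrI /(mulIf (U0 j)).
Qed.

(* Main.v *)
Require Import Defs.
From HB Require Import structures.
From mathcomp Require Import all_boot all_order all_algebra.
From mathcomp Require Import boolp classical_sets fsbigop.
From mathcomp Require Import ring zify.

(** Write [rho = E 3 / E 1] and let [V3] be the substitution of [q ^ 3] for [q].
    Then [zetaV = q (rho * V3 rho) ^ 3], and every series that occurs is a monomial
    in [q] and [rho] times a series in [q ^ 3]. So the extraction of a progression
    modulo 3 from such a monomial amounts to the component in [q ^ 3] of a power
    of [zetaV], which is by definition a row of [M].

    Concretely, the generating function of [RD 3 3 27] is
    [(E 3 E 27 / (E 1 E 81)) ^ 3], that is, [rho ^ 3] divided by the cube of the
    threefold image of [rho] by [V3] ([RD_gf], [RD3gfE]). Taking the residues 2 and 0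
    reads off rows 1 and 3 of [M] and gives the vector [y 2]; residue 2 then applies
    the rows [4 i - 3], which is multiplication by [B], and after that residue 1
    applies the rows [4 i - 2] again and again, which is multiplication by [A]
    ([sec2_hterm], [sec1_gterm], [chainP]).

    The rows of [M] have to be shown to exist. This rests on the modular equation
    [zeta ^ 3 + 9 zeta ^ 2 + 27 zeta = T] ([zetaV_cubic]), which turns into a
    recurrence for the rows ([row_exists]). The equation has two ingredients.
    Jacobi's series for [E 1 ^ 3] shows that [E 1 ^ 3 = V3 p - 3 q E 9 ^ 3] for
    some [p], with no component of residue 2 ([sec_E1_cube]). The product of
    [E 1 (w q)] over the cube roots of unity [w] is [E 3 ^ 4 / E 9]
    ([norm3_E1]). The norm of the binomial [V3 p - 3 q E 9 ^ 3] is
    [V3 p ^ 3 - 27 q ^ 3 E 9 ^ 9], and equating both values of the norm of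
    [E 1 ^ 3] gives the modular equation.

    Jacobi's series is obtained from the finite triple product: its coefficients are
    defined by their recurrence in the number of factors, evaluated in closed
    form ([triple_coef_closed]), and combined into the derivative at [z = 1]
    ([sum_triple_coef]). *)

Set Implicit Arguments.
Unset Strict Implicit.
Unset Printing Implicit Defensive.

Import GRing.Theory.
Local Open Scope ring_scope.

(** * Truncation and the 3-dissection *)

Lemma fcoef_sum (I : Type) (r : seq I) (P : pred I) (F : I -> fps int) n :
  fcoef (\sum_(i <- r | P i) F i) n = \sum_(i <- r | P i) fcoef (F i) n.
Proof. by elim/big_rec2: _ => // i a b _ <-. Qed.

(** Congruence modulo [q ^ n]; infinite products and series are only ever handled
    through such truncations. *)
Definition eqm (n : nat) (f g : fps int) := forall i, (i < n)%N -> fcoef f i = fcoef g i.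

Lemma eqm_sym n f g : eqm n f g -> eqm n g f.
Proof. by move=> e i /e. Qed.

Lemma eqm_trans n g f h : eqm n f g -> eqm n g h -> eqm n f h.
Proof. by move=> e1 e2 i lin; rewrite e1 ?e2. Qed.

Lemma eqm_le m n f g : (m <= n)%N -> eqm n f g -> eqm m f g.
Proof. by move=> lemn e i ltim; apply: e; apply: leq_trans lemn. Qed.

Lemma eqmD n f g f' g' : eqm n f f' -> eqm n g g' -> eqm n (f + g) (f' + g').
Proof. by move=> e1 e2 i lin; rewrite !fcoefD e1 ?e2. Qed.

Lemma eqmN n f f' : eqm n f f' -> eqm n (- f) (- f').
Proof. by move=> e i lin; rewrite !fcoefN e. Qed.

Lemma eqmM n f g f' g' : eqm n f f' -> eqm n g g' -> eqm n (f * g) (f' * g').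
Proof.
move=> e1 e2 i lin; rewrite !fcoefM; apply: eq_bigr => j _.
by rewrite e1 ?e2 //; apply: leq_ltn_trans lin; rewrite ?leq_subr // -ltnS.
Qed.

Lemma eqmX n f f' k : eqm n f f' -> eqm n (f ^+ k) (f' ^+ k).
Proof. by move=> e; elim: k => // k IH; rewrite !exprS; apply: eqmM. Qed.

Lemma eqm_sum n (I : Type) (r : seq I) (P : pred I) (F G : I -> fps int) :
  (forall i, P i -> eqm n (F i) (G i)) ->
  eqm n (\sum_(i <- r | P i) F i) (\sum_(i <- r | P i) G i).
Proof. by move=> e; elim/big_rec2: _ => // i a b Pi eab; apply: eqmD => //; apply: e. Qed.

Lemma eqm_prod n (I : Type) (r : seq I) (P : pred I) (F G : I -> fps int) :
  (forall i, P i -> eqm n (F i) (G i)) ->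
  eqm n (\prod_(i <- r | P i) F i) (\prod_(i <- r | P i) G i).
Proof. by move=> e; elim/big_rec2: _ => // i a b Pi eab; apply: eqmM => //; apply: e. Qed.

Lemma eqm_eq f g : (forall n, eqm n f g) -> f = g.
Proof. by move=> e; apply: fpsP => n; apply: (e n.+1). Qed.

Lemma eqm_qXM n m f : (n <= m)%N -> eqm n (q ^+ m * f) 0.
Proof. by move=> le i lt; rewrite fcoefqXM leqNgt (leq_trans lt le). Qed.

Lemma eqm_1BqX n m : (n <= m)%N -> eqm n (1 - q ^+ m) 1.
Proof.
move=> le; rewrite -[X in eqm n _ X]subr0; apply: eqmD => //; apply: eqmN.
by rewrite -[q ^+ m]mulr1; apply: eqm_qXM.
Qed.

(** Truncations of [E r], all with the same number of factors so that they can be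
    compared for different [r]. *)
Definition euler (N r : nat) : fps int := \prod_(1 <= m < N.+1) (1 - q ^+ (m * r)).

Lemma eqm_prod1 n (I : Type) (r : seq I) (P : pred I) (F : I -> fps int) :
  (forall i, P i -> eqm n (F i) 1) -> eqm n (\prod_(i <- r | P i) F i) 1.
Proof.
by move=> e; elim/big_rec: _ => // i f Pi ef; rewrite -[1]mulr1; apply: eqmM => //; apply: e.
Qed.

Lemma euler_unit N r : (0 < r)%N -> euler N r \is a GRing.unit.
Proof.
move=> r0; rewrite fps_unitE.
have : eqm 1 (euler N r) 1.
  rewrite /euler big_nat; apply: eqm_prod1 => m /andP[m1 _].
  by apply: eqm_1BqX; rewrite muln_gt0 m1.
by move=> -> //; rewrite fcoef1 unitr1.
Qed.

Lemma eqm_prod_tail K N N' (F : nat -> fps int) : (N <= N')%N ->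
  (forall m, (N < m)%N -> eqm K (F m) 1) ->
  eqm K (\prod_(1 <= m < N'.+1) F m) (\prod_(1 <= m < N.+1) F m).
Proof.
move=> le e; rewrite (big_cat_nat _ (n := N.+1)) //=.
rewrite -[X in eqm K _ X]mulr1; apply: eqmM => //.
by rewrite big_nat; apply: eqm_prod1 => m /andP[m1 _]; apply: e.
Qed.

(** The omitted factors start at exponent [N.+1 * r], so the precision grows with
    [r]; this is needed when the product runs over the multiples of [r] up to a
    given bound. *)
Lemma eqm_euler N r n : (0 < r)%N -> (n <= N.+1 * r)%N -> eqm n (euler N r) (E r).
Proof.
move=> r0 le i lt; rewrite -(EP (N := maxn i N)) ?leq_maxl //.
apply/esym; apply: eqm_prod_tail lt; first exact: leq_maxr.
by move=> m ltm; apply: eqm_1BqX; apply: leq_trans le _; rewrite leq_mul2r ltm orbT.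
Qed.

(** The three components of the 3-dissection
    [f = f_0 (q ^ 3) + q f_1 (q ^ 3) + q ^ 2 f_2 (q ^ 3)]; [sec 0] is Atkin's
    operator [U_3]. *)
Definition sec (r : nat) (f : fps int) : fps int := Fps (fun n => fcoef f (3 * n + r)).

(** The substitution of [q ^ 3] for [q], a right inverse of [sec 0]. *)
Definition V3 (f : fps int) : fps int :=
  Fps (fun n => if (3 %| n)%N then fcoef f (n %/ 3) else 0).

Lemma sec_is_additive r : nmod_morphism (sec r).
Proof. by split => [|f g]; apply: fpsP. Qed.
HB.instance Definition _ r := GRing.isNmodMorphism.Build _ _ (sec r) (sec_is_additive r).

Lemma sec_natM r n f : sec r (n%:R * f) = n%:R * sec r f.
Proof. by rewrite !mulr_natl raddfMn. Qed.

Lemma sum_multiples3 (r m : nat) (F : nat -> int) : (r < 3)%N ->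
  \sum_(0 <= i < (3 * m + r).+1) (if (3 %| i)%N then F i else 0) =
  \sum_(0 <= j < m.+1) F (3 * j)%N.
Proof.
move=> r3; elim: m => [|m IH].
  rewrite muln0 add0n big_nat1 muln0.
  by case: r r3 => [|[|[|r]]] // _; rewrite /index_iota /= !big_cons big_nil /= !addr0.
have -> : ((3 * m.+1 + r).+1 = (3 * m + r).+1.+3)%N by lia.
rewrite !(big_nat_recr _.+1) //= IH -[LHS]addrA -addrA; congr (_ + _).
have H (i : nat) : i != (3 * m.+1)%N -> (3 * m + r < i < 3 * m + r + 4)%N ->
    (if (3 %| i)%N then F i else 0) = 0.
  by move=> ne lt; case: ifP => // /dvdnP[k kE]; lia.
have D : (3 %| 3 * m.+1)%N by rewrite dvdn_mulr.
case: r r3 H {IH} => [|[|[|r]]] // _ H.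
- rewrite (H (3 * m + 0).+1) ?(H (3 * m + 0).+2); [|lia..].
  by rewrite (_ : (3 * m + 0).+3 = 3 * m.+1)%N ?D ?add0r //; lia.
- rewrite (H (3 * m + 1).+1) ?(H (3 * m + 1).+3); [|lia..].
  by rewrite (_ : (3 * m + 1).+2 = 3 * m.+1)%N ?D ?add0r ?addr0 //; lia.
rewrite (H (3 * m + 2).+2) ?(H (3 * m + 2).+3); [|lia..].
by rewrite (_ : (3 * m + 2).+1 = 3 * m.+1)%N ?D ?add0r ?addr0 //; lia.
Qed.

(** Series in [q ^ 3] are scalars for the dissection. Every later computation of
    a component consists in splitting off such a scalar. *)
Lemma sec_V3M r f g : (r < 3)%N -> sec r (V3 f * g) = f * sec r g.
Proof.
move=> r3; apply: fpsP => n; rewrite -[LHS]/(fcoef (V3 f * g) (3 * n + r)) !fcoefM.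
pose G i := fcoef f (i %/ 3) * fcoef g (3 * n + r - i).
transitivity (\sum_(0 <= i < (3 * n + r).+1) (if (3 %| i)%N then G i else 0)).
  by rewrite big_mkord; apply: eq_bigr => i _ /=; case: ifP; rewrite ?mul0r.
rewrite sum_multiples3 // big_mkord; apply: eq_bigr => i _ /=.
by rewrite /G mulKn //; congr (_ * fcoef g _); have := ltn_ord i; lia.
Qed.

Lemma sec_ext f g : (forall r, (r < 3)%N -> sec r f = sec r g) -> f = g.
Proof.
move=> e; apply: fpsP => n; have := e (n %% 3)%N (ltn_pmod n (isT : (0 < 3)%N)).
by move=> /(congr1 (fun h => fcoef h (n %/ 3)%N)) /=; rewrite mulnC -divn_eq.
Qed.

Lemma sec_V3 r f : (r < 3)%N -> sec r (V3 f) = if r == 0%N then f else 0.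
Proof.
move=> r3; apply: fpsP => n /=.
case: r r3 => [|[|[|r]]] // _ /=; first by rewrite addn0 dvdn_mulr // mulKn.
all: by case: ifP => // /dvdnP[k]; lia.
Qed.

Lemma V3_is_additive : zmod_morphism V3.
Proof. by move=> f g; apply: fpsP => n /=; case: ifP; rewrite ?subr0. Qed.
HB.instance Definition _ := GRing.isZmodMorphism.Build _ _ V3 V3_is_additive.

Lemma V3_is_multiplicative : monoid_morphism V3.
Proof.
split=> [|f g].
  apply: fpsP => n /=; case: ifP => [/dvdnP[k ->]|].
    by rewrite mulnK //; case: k.
  by case: n.
apply: sec_ext => r r3; rewrite sec_V3M // !sec_V3 //.
by case: ifP; rewrite ?mulr0.
Qed.
HB.instance Definition _ := GRing.isMonoidMorphism.Build _ _ V3 V3_is_multiplicative.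

Lemma V3_inj : injective V3.
Proof. by move=> f g /(congr1 (sec 0)); rewrite !sec_V3. Qed.

Lemma V3q : V3 q = q ^+ 3.
Proof.
apply: fpsP => n; rewrite -[q ^+ 3]mulr1 fcoefqXM fcoef1 /=.
by case: n => [|[|[|[|n]]]] //=; case: ifP => // /dvdnP[[|[|k]] kE] //; lia.
Qed.

Lemma eqm_V3 n f g : eqm n f g -> eqm n (V3 f) (V3 g).
Proof.
by move=> e i lt /=; case: ifP => // _; apply: e; apply: leq_ltn_trans (leq_div i 3) lt.
Qed.

Lemma eqm_sec n r f g : (r < 3)%N -> eqm (3 * n) f g -> eqm n (sec r f) (sec r g).
Proof. by move=> r3 e i lt /=; apply: e; lia. Qed.

Lemma V3euler N r : V3 (euler N r) = euler N (3 * r).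
Proof.
rewrite rmorph_prod; apply: eq_bigr => m _.
by rewrite rmorphB rmorph1 rmorphXn /= V3q -exprM mulnCA.
Qed.

Lemma V3E r : (0 < r)%N -> V3 (E r) = E (3 * r).
Proof.
move=> r0; apply: eqm_eq => n.
have e3 : eqm n (euler n (3 * r)) (E (3 * r)) by apply: eqm_euler; nia.
apply: eqm_trans e3; rewrite -V3euler.
by apply: eqm_V3; apply: eqm_sym; apply: eqm_euler => //; nia.
Qed.

Lemma sec0qM f : sec 0 (q * f) = q * sec 2 f.
Proof.
apply: fpsP => n; rewrite -[LHS]/(fcoef (q * f) (3 * n + 0)) addn0 !fcoefqM.
by case: n => [|n] //; rewrite (_ : (3 * n.+1 = (3 * n + 2).+1)%N); last lia.
Qed.

Lemma sec1qM f : sec 1 (q * f) = sec 0 f.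
Proof. by apply: fpsP => n; rewrite -[LHS]/(fcoef (q * f) (3 * n + 1)) addn1 fcoefqM /= addn0. Qed.

Lemma sec2qM f : sec 2 (q * f) = sec 1 f.
Proof. by apply: fpsP => n; rewrite -[LHS]/(fcoef (q * f) (3 * n + 2)) addn2 fcoefqM /= addn1. Qed.

Lemma qM_inj : injective ( *%R q).
Proof.
move=> f g e; apply: fpsP => n.
by have := congr1 (fun h => fcoef h n.+1) e; rewrite !fcoefqM.
Qed.

Lemma trisect f : f = V3 (sec 0 f) + q * V3 (sec 1 f) + q ^+ 2 * V3 (sec 2 f).
Proof.
apply: sec_ext => r r3; rewrite expr2 -!mulrA !raddfD /=.
by case: r r3 => [|[|[|r]]] // _;
  rewrite ?(sec0qM, sec1qM, sec2qM) !sec_V3 //= ?mulr0 ?addr0 ?add0r.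
Qed.

(** * The norm of the 3-dissection *)

Lemma sec_mul f g :
  [/\ sec 0 (f * g) =
        sec 0 f * sec 0 g + q * (sec 1 f * sec 2 g + sec 2 f * sec 1 g),
      sec 1 (f * g) =
        sec 0 f * sec 1 g + sec 1 f * sec 0 g + q * (sec 2 f * sec 2 g)
    & sec 2 (f * g) =
        sec 0 f * sec 2 g + sec 1 f * sec 1 g + sec 2 f * sec 0 g].
Proof.
have secE r : (r < 3)%N -> sec r (f * g) =
    sec 0 f * sec r g + sec 1 f * sec r (q * g) + sec 2 f * sec r (q * (q * g)).
  move=> r3; rewrite {1}[f]trisect.
  rewrite (_ : _ * g = V3 (sec 0 f) * g + V3 (sec 1 f) * (q * g)
                     + V3 (sec 2 f) * (q * (q * g))); last by ring.
  by rewrite !raddfD /= !sec_V3M.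
by split; rewrite secE // ?(sec0qM, sec1qM, sec2qM); ring.
Qed.

Lemma sec_one r : (r < 3)%N -> sec r 1 = if r == 0%N then 1 else 0.
Proof. by move=> r3; rewrite -{1}(rmorph1 V3) sec_V3. Qed.

(** The norm from series in [q] to series in [q ^ 3], written in the variable [q]:
    [V3 (norm3 f)] is the product of [f (w q)] over the cube roots of unity [w].
    This cubic form in the components avoids adjoining [w]. *)
Definition norm3 f : fps int :=
  sec 0 f ^+ 3 + q * sec 1 f ^+ 3 + q ^+ 2 * sec 2 f ^+ 3
  - 3 * q * (sec 0 f * sec 1 f * sec 2 f).

Lemma norm3M f g : norm3 (f * g) = norm3 f * norm3 g.
Proof. rewrite /norm3; have [-> -> ->] := sec_mul f g; ring. Qed.

Lemma norm3X f k : norm3 (f ^+ k) = norm3 f ^+ k.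
Proof.
elim: k => [|k IH]; last by rewrite !exprS norm3M IH.
rewrite !expr0 /norm3 !sec_one //=; ring.
Qed.

Lemma eqm_norm3 n f g : eqm (3 * n) f g -> eqm n (norm3 f) (norm3 g).
Proof.
move=> e; have s r : (r < 3)%N -> eqm n (sec r f) (sec r g) by move=> r3; apply: eqm_sec.
have [[s0 s1] s2] := (s 0%N isT, s 1%N isT, s 2%N isT).
by rewrite /norm3; repeat first [done | exact: s0 | exact: s1 | exact: s2
  | apply: eqmD | apply: eqmN | apply: eqmX | apply: eqmM].
Qed.

Lemma sec_1BqX n :
  [/\ sec 0 (1 - q ^+ (3 * n)) = 1 - q ^+ n, sec 1 (1 - q ^+ (3 * n)) = 0
    & sec 2 (1 - q ^+ (3 * n)) = 0].
Proof.
have -> : 1 - q ^+ (3 * n) = V3 (1 - q ^+ n) by rewrite rmorphB rmorph1 rmorphXn /= V3q exprM.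
by rewrite !sec_V3.
Qed.

Lemma norm3_1BqX0 n : norm3 (1 - q ^+ (3 * n)) = (1 - q ^+ n) ^+ 3.
Proof. rewrite /norm3; have [-> -> ->] := sec_1BqX n; ring. Qed.

Lemma norm3_1BqX r n : (0 < r < 3)%N ->
  norm3 (1 - q ^+ (3 * n + r)) = 1 - q ^+ (3 * n + r).
Proof.
have e : q ^+ (3 * n) = V3 (q ^+ n) by rewrite rmorphXn /= V3q exprM.
rewrite exprD e /norm3; case: r => [|[|[|r]]] // _;
  rewrite ?expr1 ?expr2 !raddfB /= [V3 _ * _]mulrC -?mulrA.
  rewrite !(sec0qM, sec1qM, sec2qM, sec_V3, sec_one) //= -?e exprM exprAC.
  ring.
rewrite !(sec0qM, sec1qM, sec2qM, sec_V3, sec_one) //= -?e exprM exprAC.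
ring.
Qed.

(** Three consecutive factors have norms [1 - q ^ (3 n + 1)], [1 - q ^ (3 n + 2)]
    and [(1 - q ^ (n + 1)) ^ 3]; the missing [1 - q ^ (3 n + 3)] is supplied by the
    extra factor of [euler n 3]. *)
Lemma norm3_euler n : norm3 (euler (3 * n) 1) * euler n 3 = euler (3 * n) 1 * euler n 1 ^+ 3.
Proof.
elim: n => [|n IH].
  by rewrite /euler !big_nil -{1}(expr0 (0 : fps int)) norm3X expr0 expr1n !mulr1.
have e3 : euler (3 * n.+1) 1 = euler (3 * n) 1 *
   ((1 - q ^+ (3 * n + 1)) * (1 - q ^+ (3 * n + 2)) * (1 - q ^+ (3 * n.+1))).
  rewrite /euler (_ : (3 * n.+1).+1 = (3 * n).+1.+3)%N; last lia.
  rewrite !(big_nat_recr _.+1) //= !muln1 -!mulrA addn1 addn2.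
  by rewrite (_ : 3 * n.+1 = (3 * n).+3)%N; last lia.
have e1 r : euler n.+1 r = euler n r * (1 - q ^+ (n.+1 * r)).
  by rewrite /euler big_nat_recr.
rewrite e3 !norm3M norm3_1BqX0 !norm3_1BqX // !e1 muln1 [(n.+1 * 3)%N]mulnC.
transitivity (norm3 (euler (3 * n) 1) * euler n 3 * (
   ((1 - q ^+ (3 * n + 1)) * (1 - q ^+ (3 * n + 2)) * (1 - q ^+ n.+1) ^+ 3)
   * (1 - q ^+ (3 * n.+1)))); first by ring.
rewrite IH; ring.
Qed.

Lemma norm3_E1 : norm3 (E 1) * E 3 = E 1 ^+ 4.
Proof.
apply: eqm_eq => n.
have e1 : eqm (3 * n) (euler (3 * n) 1) (E 1) by apply: eqm_euler; lia.
have e2 : eqm n (euler n 1) (E 1) by apply: eqm_euler; lia.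
have e3 : eqm n (euler n 3) (E 3) by apply: eqm_euler; lia.
apply: eqm_trans (eqmM (eqm_sym (eqm_norm3 e1)) (eqm_sym e3)) _.
rewrite norm3_euler [E 1 ^+ 4]exprS; apply: eqmM; last by apply: eqmX.
by apply: eqm_le e1; lia.
Qed.

(** * Jacobi's identity for the cube of Euler's product *)

(** For [k >= 0], the coefficient of [z ^ k] in the Laurent polynomial
    [(1 - 1/z) prod_(1 <= m <= n) (1 - z q ^ m) (1 - q ^ m / z)]. Replacing [z] by
    [1/z] multiplies it by [-z], so the coefficient at [-1 - k] is the opposite of
    the one at [k]; hence the value [- triple_coef n' 0] used at [-1]. *)
Fixpoint triple_coef (n k : nat) : fps int :=
  if n is n'.+1 then
    (1 + q ^+ (2 * n)) * triple_coef n' k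
    - q ^+ n * ((if k is k'.+1 then triple_coef n' k' else - triple_coef n' 0)
                + triple_coef n' k.+1)
  else (k == 0%N)%:R.

Lemma triple_coefS n k : triple_coef n.+1 k = (1 + q ^+ (2 * n.+1)) * triple_coef n k
    - q ^+ n.+1 * ((if k is k'.+1 then triple_coef n k' else - triple_coef n 0)
                   + triple_coef n k.+1).
Proof. by []. Qed.

Lemma triple_coef_gt n k : (n < k)%N -> triple_coef n k = 0.
Proof.
elim: n k => [|n IH] [|k] // lt; rewrite triple_coefS !IH //; [ring|lia..].
Qed.

Lemma sum_triple_coef_widen n N (c : nat -> fps int) : (n < N)%N ->
  \sum_(0 <= k < N) c k * triple_coef n k = \sum_(0 <= k < n.+1) c k * triple_coef n k.
Proof.
move=> lt; rewrite (big_cat_nat _ (n := n.+1)) //=.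
rewrite [X in _ + X]big_nat [X in _ + X]big1 ?addr0 // => k /andP[lt1 _].
by rewrite triple_coef_gt ?mulr0.
Qed.

(** The derivative at [z = 1] of the Laurent polynomial above: by the symmetry
    [k <-> -1 - k] the pair of terms contributes [k - (-1 - k) = 2 k + 1]. On
    coefficients, passing from [n] to [n + 1] multiplies the sum by
    [(1 - q ^ (n + 1)) ^ 2], because the two shifted sums [s1] and [s2] add up to
    twice the sum, up to a boundary term. *)
Lemma sum_triple_coef n : \sum_(0 <= k < n.+1) (2 * k + 1)%:R * triple_coef n k = euler n 1 ^+ 2.
Proof.
elim: n => [|n IH].
  by rewrite big_nat1 /euler big_nil /= mulr1 expr1n.
have -> : euler n.+1 1 = euler n 1 * (1 - q ^+ n.+1).
  by rewrite /euler big_nat_recr //= muln1.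
pose S := \sum_(0 <= k < n.+2) (2 * k + 1)%:R * triple_coef n k.
have SE : S = euler n 1 ^+ 2.
  by rewrite -IH /S sum_triple_coef_widen.
pose s1 := \sum_(0 <= k < n.+1) (2 * k + 3)%:R * triple_coef n k.
pose s2 := \sum_(0 <= k < n.+1) (2 * k + 1)%:R * triple_coef n k.+1.
have s12 : s1 + s2 = 2 * S + triple_coef n 0.
  rewrite /s2.
  have -> : \sum_(0 <= k < n.+1) (2 * k + 1)%:R * triple_coef n k.+1 =
            \sum_(0 <= k < n.+2) ((2 * k)%:R - 1) * triple_coef n k + triple_coef n 0.
    rewrite [in RHS]big_nat_recl //= mulr0n sub0r mulN1r addrAC addNr add0r.
    apply: eq_bigr => k _; congr (_ * _).
    by rewrite (_ : 2 * k.+1 = (2 * k + 1).+1)%N ?mulrSr ?addrK //; lia.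
  rewrite addrA; congr (_ + _).
  rewrite /s1 -(@sum_triple_coef_widen n n.+2) // -big_split /S mulr_sumr /=.
  by apply: eq_bigr => k _; ring.
transitivity ((1 + q ^+ (2 * n.+1)) * S - q ^+ n.+1 * (s1 + s2 - triple_coef n 0)).
  under eq_bigr do rewrite triple_coefS.
  have -> : \sum_(0 <= k < n.+2) (2 * k + 1)%:R * ((1 + q ^+ (2 * n.+1)) * triple_coef n k -
     q ^+ n.+1 * ((if k is k'.+1 then triple_coef n k' else - triple_coef n 0)
                  + triple_coef n k.+1)) =
     (1 + q ^+ (2 * n.+1)) * S - q ^+ n.+1 * (
     \sum_(0 <= k < n.+2) (2 * k + 1)%:R *
       (if k is k'.+1 then triple_coef n k' else - triple_coef n 0)
     + \sum_(0 <= k < n.+2) (2 * k + 1)%:R * triple_coef n k.+1).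
    rewrite -big_split /= /S !mulr_sumr -sumrB; apply: eq_bigr => k _; ring.
  congr (_ - _ * _).
  rewrite big_nat_recl //= [X in _ + X]big_nat_recr //=.
  rewrite (@triple_coef_gt n n.+2) // mulr0 addr0 -/s2.
  have -> : \sum_(0 <= i < n.+1) (2 * i.+1 + 1)%:R * triple_coef n i = s1.
    by apply: eq_bigr => k _; congr (_%:R * _); lia.
  rewrite muln0 add0n; ring.
rewrite s12 SE mulnC exprM; ring.
Qed.

Definition poch n : fps int := euler n 1.

Lemma pochS n : poch n.+1 = poch n * (1 - q ^+ n.+1).
Proof. by rewrite /poch /euler big_nat_recr //= muln1. Qed.

Lemma poch_unit n : poch n \is a GRing.unit.
Proof. exact: euler_unit. Qed.

(** The limit of [triple_coef n k * E 1] as [n] grows, that is, the general term of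
    the theta series in Jacobi's triple product. *)
Definition theta_term k : fps int := (-1) ^+ k * q ^+ 'C(k.+1, 2).

Lemma theta_termS k : theta_term k.+1 = - (q ^+ k.+1 * theta_term k).
Proof. rewrite /theta_term binS bin1 exprD [(-1) ^+ k.+1]exprS; ring. Qed.

(** The coefficient is [theta_term k] times the Gaussian binomial of [2 n + 1] over
    [n - k], where [n = k + m]; denominators are cleared. Induction on [n]: all three
    terms of the recurrence become the same product times a polynomial in
    [q ^ k] and [q ^ m]. *)
Lemma triple_coef_closed k m :
  triple_coef (k + m) k * (poch m * poch (2 * k + m).+1) =
  theta_term k * poch (2 * (k + m)).+1.
Proof.
have [n nE] : exists n, n = (k + m)%N by exists (k + m)%N.
rewrite -nE; elim: n k m nE => [|n IH] k m nE.
  have [-> ->] : k = 0%N /\ m = 0%N by lia.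
  by rewrite /theta_term /= /poch /euler !big_nil !mul1r.
(* For m = 0 or 1 the entries outside the triangle vanish, as do the right-hand sides. *)
have hc : triple_coef n k * (poch m * poch (2 * k + m).+1) =
    theta_term k * poch (2 * n).+1 * ((1 - q ^+ m) * (1 - q ^+ (2 * k + m).+1)).
  case: m nE => [|m] nE; first by rewrite triple_coef_gt ?expr0; [ring|lia].
  rewrite -(IH k m); last lia.
  rewrite addnS !pochS; ring.
have hr : triple_coef n k.+1 * (poch m * poch (2 * k + m).+1) =
    - (q ^+ k.+1 * theta_term k) * poch (2 * n).+1 * ((1 - q ^+ m) * (1 - q ^+ m.-1)).
  case: m nE {hc} => [|[|m]] nE; [by rewrite triple_coef_gt ?expr0; [ring|lia]..|].
  rewrite -theta_termS -(IH k.+1 m); last lia.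
  rewrite (_ : (2 * k + m.+2).+1 = (2 * k.+1 + m).+1)%N; last lia.
  rewrite !pochS /=; ring.
have hl : q ^+ k * ((if k is k'.+1 then triple_coef n k' else - triple_coef n 0) *
      (poch m * poch (2 * k + m).+1)) =
    - theta_term k * poch (2 * n).+1 * ((1 - q ^+ (2 * k + m)) * (1 - q ^+ (2 * k + m).+1)).
  case: k nE {hc hr} => [|k] nE.
    rewrite (_ : m = n.+1); last lia.
    have := IH 0%N n erefl; rewrite muln0 !add0n => IH0.
    rewrite [- theta_term 0 * _]mulNr -IH0 !pochS; ring.
  rewrite theta_termS.
  rewrite (_ : (2 * k.+1 + m)%N = (2 * k + m).+2)%N; last lia.
  have IHk := IH k m _; rewrite (pochS (2 * k + m).+2) (pochS (2 * k + m).+1).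
  transitivity (q ^+ k.+1 * (triple_coef n k * (poch m * poch (2 * k + m).+1)) *
    ((1 - q ^+ (2 * k + m).+2) * (1 - q ^+ (2 * k + m).+3))); first by ring.
  rewrite IHk; [ring|lia].
transitivity ((1 + q ^+ (2 * n.+1)) * (triple_coef n k * (poch m * poch (2 * k + m).+1))
   - q ^+ m * (q ^+ k * ((if k is k'.+1 then triple_coef n k' else - triple_coef n 0) *
      (poch m * poch (2 * k + m).+1)))
   - q ^+ n.+1 * (triple_coef n k.+1 * (poch m * poch (2 * k + m).+1))).
  rewrite triple_coefS.
  move: (if k is k'.+1 then triple_coef n k' else - triple_coef n 0 : fps int) => L.
  rewrite nE (exprD _ k m); ring.
rewrite hc hr hl (_ : (2 * n.+1).+1 = (2 * n).+3)%N; last lia.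
rewrite !pochS.
have -> : q ^+ (2 * n.+1) = q ^+ k * q ^+ k * (q ^+ m * q ^+ m).
  by rewrite nE mulnC exprM !expr2 exprD mulrACA.
have -> : q ^+ (2 * n).+2 = q ^+ k * q ^+ k * (q ^+ m * q ^+ m).
  by rewrite (_ : (2 * n).+2 = (k + k + (m + m))%N) ?exprD //; lia.
have -> : q ^+ (2 * n).+3 = q ^+ k * q ^+ k * (q ^+ m * q ^+ m) * q.
  by rewrite (_ : (2 * n).+3 = (k + k + (m + m)).+1%N) ?exprSr ?exprD //; lia.
have -> : q ^+ (2 * k + m).+1 = q ^+ k * q ^+ k * q ^+ m * q.
  by rewrite exprSr mul2n -addnn !exprD.
have -> : q ^+ (2 * k + m) = q ^+ k * q ^+ k * q ^+ m by rewrite mul2n -addnn !exprD.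
have -> : q ^+ n.+1 = q ^+ k * q ^+ m by rewrite nE exprD.
rewrite exprSr.
(* The exponent m - 1 in hr is truncated; for m = 0 the other factor, 1 - q ^ 0, is zero. *)
case: m {nE hc hr hl} => [|m] /=; first by rewrite !expr0; ring.
rewrite !exprSr; ring.
Qed.

Lemma eqm0M n (f g : fps int) : eqm n f 0 -> eqm n (f * g) 0.
Proof. by move=> e; rewrite -[X in eqm n _ X](mul0r g); apply: eqmM. Qed.

Lemma eqm_theta_term n k : (n <= k)%N -> eqm n (theta_term k) 0.
Proof.
by move=> le; rewrite /theta_term mulrC; apply: eqm_qXM; rewrite binS bin1; lia.
Qed.

(** Jacobi's expansion of [E 1 ^ 3], the limit of [sum_triple_coef]: for [k < n] each
    Gaussian binomial is close to [1 / E 1], and the terms with [k >= n] vanish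
    modulo [q ^ n] because of [theta_term k]. *)
Lemma jacobi n :
  eqm n (E 1 ^+ 3) (\sum_(0 <= k < n) (2 * k + 1)%:R * theta_term k).
Proof.
have pE N : (n <= N.+1)%N -> eqm n (poch N) (E 1) by move=> le; apply: eqm_euler; lia.
have jE k : (k < n)%N -> eqm n (triple_coef (2 * n) k * E 1) (theta_term k).
  move=> ltk.
  have := @triple_coef_closed k (2 * n - k); rewrite subnKC; last lia.
  set u := poch _; set v := poch _; set w := poch _ => jc.
  have [uE vE wE] : [/\ eqm n u (E 1), eqm n v (E 1) & eqm n w (E 1)].
    by split; apply: pE; lia.
  rewrite -(mulrK (E_unit 1) (_ * E 1)) -[theta_term k](mulrK (E_unit 1)).
  apply: eqmM => //; apply: eqm_trans (_ : eqm n (theta_term k * w) _).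
    by rewrite -jc -mulrA; apply: eqmM => //; apply: eqmM; apply: eqm_sym.
  by apply: eqmM.
have e1 : eqm n (E 1 ^+ 3) (poch (2 * n) ^+ 2 * E 1).
  rewrite exprSr; apply: eqmM => //; apply: eqm_sym; apply: eqmX; apply: pE; lia.
apply: eqm_trans e1 _; rewrite -sum_triple_coef mulr_suml.
rewrite (big_cat_nat _ (n := n)) //=; last lia.
rewrite -[X in eqm n _ X]addr0; apply: eqmD.
  rewrite !big_nat; apply: eqm_sum => k /andP[_ ltk].
  by rewrite -mulrA; apply: eqmM => //; apply: jE.
rewrite big_nat; elim/big_rec: _ => // k f /andP[lek ltk] ef.
rewrite -[X in eqm n _ X]addr0; apply: eqmD => //.
have := @triple_coef_closed k (2 * n - k); rewrite subnKC; last lia.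
set u := poch _; set v := poch _ => jc.
rewrite -[triple_coef _ _](mulrK (_ : u * v \is a GRing.unit)); last by rewrite unitrM !poch_unit.
rewrite jc -(mulrA (theta_term k)) mulrCA -[X in eqm n X]mulrA.
by apply: eqm0M; apply: eqm_theta_term.
Qed.

Lemma double_bin2 m : (2 * 'C(m.+1, 2) = m.+1 * m)%N.
Proof. by elim: m => // m IH; rewrite binS bin1 mulnDr IH; lia. Qed.

(** Triangular numbers are 0 or 1 modulo 3, and those congruent to 1 have index
    [k = 3 n + 1], for which [k (k + 1) / 2 = 9 n (n + 1) / 2 + 1] and
    [2 k + 1 = 3 (2 n + 1)]: this part of the series is a copy of the whole. *)
Lemma sec_jacobi_sum n (J := fun m => \sum_(0 <= k < m) (2 * k + 1)%:R * theta_term k) :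
  sec 1 (J (3 * n)%N) = - 3 * V3 (J n) /\ sec 2 (J (3 * n)%N) = 0.
Proof.
have secs r (k : nat) f : sec r ((-1) ^+ k * f) = (-1) ^+ k * sec r f.
  by rewrite -signr_odd; case: odd; rewrite ?expr0 ?expr1 ?mul1r // !mulN1r raddfN.
have V3sX m : q ^+ (3 * m) = V3 (q ^+ m) by rewrite rmorphXn /= V3q exprM.
elim: n => [|n [IH1 IH2]].
  by rewrite muln0 /J !big_geq // !raddf0 mulr0.
have JS m : J m.+1 = J m + (2 * m + 1)%:R * theta_term m by rewrite /J big_nat_recr.
have -> : (3 * n.+1 = (3 * n).+3)%N by lia.
have [b0 b1 b2 b3] := And4 (double_bin2 (3 * n)) (double_bin2 (3 * n).+1)
  (double_bin2 (3 * n).+2) (double_bin2 n).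
have j0 : exists a, theta_term (3 * n) = (-1) ^+ (3 * n) * V3 (q ^+ a).
  exists (3 * 'C(n.+1, 2) - n)%N; rewrite -V3sX /theta_term; congr (_ * q ^+ _); nia.
have j1 : theta_term (3 * n).+1 = (-1) ^+ (3 * n).+1 * (q * V3 (q ^+ (3 * 'C(n.+1, 2)))).
  rewrite -V3sX -exprS /theta_term; congr (_ * q ^+ _); nia.
have j2 : exists a, theta_term (3 * n).+2 = (-1) ^+ (3 * n).+2 * V3 (q ^+ a).
  exists (3 * 'C(n.+1, 2) + n + 1)%N; rewrite -V3sX /theta_term; congr (_ * q ^+ _); nia.
have [[a0 ja0] [a2 ja2]] := (j0, j2).
have secD r f g : sec r (f + g) = sec r f + sec r g by rewrite raddfD.
rewrite !JS ja0 j1 ja2 !secD IH1 IH2 !sec_natM !secs !(sec1qM, sec2qM) !sec_V3 //=.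
rewrite !mulr0 !addr0; split=> //.
rewrite (rmorphD V3) [RHS]mulrDr; congr (_ + _).
have s3 : (-1) ^+ (3 * n).+1 = - (-1) ^+ n :> fps int.
  by rewrite exprS mulN1r exprM -signr_odd expr1.
rewrite s3 (rmorphM V3) (rmorph_nat V3) /theta_term (rmorphM V3) (rmorphXn V3 n) /=.
rewrite (rmorphN1 V3) -V3sX.
rewrite (_ : (2 * (3 * n).+1 + 1)%:R = 3 * (2 * n + 1)%:R :> fps int); first by ring.
by rewrite -natrM; congr _%:R; lia.
Qed.

Lemma sec_E1_cube : sec 1 (E 1 ^+ 3) = - 3 * E 3 ^+ 3 /\ sec 2 (E 1 ^+ 3) = 0.
Proof.
have e n := @eqm_sec n _ _ _ (isT : (1 < 3)%N) (@jacobi (3 * n)).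
have e2 n := @eqm_sec n _ _ _ (isT : (2 < 3)%N) (@jacobi (3 * n)).
have s n := sec_jacobi_sum n.
split; apply: eqm_eq => n; have [s1 s2] := s n.
  apply: eqm_trans (e n) _; rewrite s1 -(V3E (isT : (0 < 1)%N)) -rmorphXn.
  by apply: eqmM => //; apply: eqm_V3; apply: eqm_sym; apply: jacobi.
by apply: eqm_trans (e2 n) _; rewrite s2.
Qed.

(** * The modular equation and the rows of M *)

Lemma V3X f k : V3 (f ^+ k) = V3 f ^+ k. Proof. exact: rmorphXn. Qed.
Lemma V3M f g : V3 (f * g) = V3 f * V3 g. Proof. exact: rmorphM. Qed.
Lemma V3D f g : V3 (f + g) = V3 f + V3 g. Proof. exact: rmorphD. Qed.
Lemma V3N f : V3 (- f) = - V3 f. Proof. exact: rmorphN. Qed.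
Lemma V3nat n : V3 n%:R = n%:R. Proof. exact: rmorph_nat. Qed.

(** Powers and numerals come first, so that they are never split as products. *)
Definition V3simp := (V3X, V3nat, V3M, V3D, V3N, V3q).

Definition E1cube0 : fps int := sec 0 (E 1 ^+ 3).

Lemma E1_cube : E 1 ^+ 3 = V3 E1cube0 - 3 * q * E 9 ^+ 3.
Proof.
rewrite [LHS]trisect; have [-> ->] := sec_E1_cube.
rewrite rmorph0 mulr0 addr0; congr (_ + _).
rewrite (rmorphM V3) (rmorphXn V3) /= (V3E (isT : (0 < 3)%N)) (rmorphN V3) (rmorph_nat V3); ring.
Qed.

(** [V3 delta] is [E 3 ^ 12 / E 9 ^ 3] (lemma [deltaE]); in this form it is visibly
    the norm of [E 1 ^ 3 = V3 E1cube0 - 3 q E 9 ^ 3]. *)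
Definition delta : fps int := E1cube0 ^+ 3 - 27 * q * E 3 ^+ 9.

Lemma deltaE : delta * E 3 ^+ 3 = E 1 ^+ 12.
Proof.
have -> : delta = norm3 (E 1 ^+ 3).
  rewrite /norm3 -/E1cube0; have [-> ->] := sec_E1_cube; rewrite /delta; ring.
by rewrite norm3X -exprMn norm3_E1 -exprM.
Qed.

Lemma delta_unit : delta \is a GRing.unit.
Proof.
have : delta * E 3 ^+ 3 \is a GRing.unit by rewrite deltaE unitrX ?E_unit.
by rewrite unitrM => /andP[].
Qed.

(** All series of the recursion are monomials in [q], [rho] and its images by [V3]:
    for instance [zetaV] is the cube of [rho * V3 rho] up to [q]. *)
Definition rho : fps int := E 3 / E 1.

Lemma rho_unit : rho \is a GRing.unit.
Proof. by rewrite unitrM unitrV !E_unit. Qed.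

Lemma V3unit f : f \is a GRing.unit -> V3 f \is a GRing.unit.
Proof. exact: rmorph_unit. Qed.

(** [1 / T] with [q] in place of [q ^ 3]. *)
Definition Tinv : fps int := q * rho ^+ 12.

Lemma V3rho : V3 rho = E 9 / E 3.
Proof. by rewrite rmorphM rmorphV ?E_unit //= !V3E. Qed.

Lemma zetaVE : zetaV = q * (rho * V3 rho) ^+ 3.
Proof.
have -> : rho * V3 rho = E 9 / E 1 by rewrite V3rho mulrC mulrA divrK ?E_unit.
by rewrite exprMn exprVn.
Qed.

Lemma TVE : TV = V3 Tinv.
Proof. by rewrite /Tinv rmorphM rmorphXn /= V3rho V3q exprMn exprVn. Qed.

Lemma EX_unit r k : E r ^+ k \is a GRing.unit.
Proof. by rewrite unitrX ?E_unit. Qed.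

Lemma Tinv_delta : Tinv * delta = q * E 3 ^+ 9.
Proof.
apply: (mulIr (EX_unit 3 3)).
rewrite -mulrA deltaE /Tinv /rho exprMn exprVn -[LHS]mulrA (divrK (EX_unit 1 12)).
by rewrite -[RHS]mulrA -exprD.
Qed.

Lemma zetaV_E1 : zetaV * E 1 ^+ 3 = q * E 9 ^+ 3.
Proof. by rewrite /zetaV -mulrA (divrK (EX_unit 1 3)). Qed.

Lemma V3delta : V3 delta = V3 E1cube0 ^+ 3 - 27 * q ^+ 3 * E 9 ^+ 9.
Proof.
by rewrite !V3simp V3E.
Qed.

(** The modular equation [T = zeta ^ 3 + 9 zeta ^ 2 + 27 zeta], divided by
    [T zeta ^ 3]: with [V3 E1cube0 = E 1 ^ 3 + 3 q E 9 ^ 3] it is the formula for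
    [V3 delta] expanded in powers of [E 1 ^ 3]. *)
Lemma zetaV_cubic : zetaV ^+ 3 = V3 Tinv * (1 + 9 * zetaV + 27 * zetaV ^+ 2).
Proof.
apply: (mulIr (unitrX 3 (EX_unit 1 3))).
have TD : V3 Tinv * V3 delta = q ^+ 3 * E 9 ^+ 9.
  by rewrite -V3M Tinv_delta !V3simp V3E.
rewrite -exprMn zetaV_E1.
transitivity (q ^+ 3 * E 9 ^+ 9); first by ring.
rewrite -TD V3delta.
have -> : V3 E1cube0 = E 1 ^+ 3 + 3 * q * E 9 ^+ 3 by rewrite E1_cube subrK.
have := zetaV_E1; move: (E 1 ^+ 3) => e ze.
transitivity (V3 Tinv * (e ^+ 3 + 9 * (q * E 9 ^+ 3) * e ^+ 2 + 27 * (q * E 9 ^+ 3) ^+ 2 * e)).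
  ring.
rewrite -ze; ring.
Qed.

(** The denominator [E 1 ^ 3] of [zetaV] is rationalized by the other two factors
    of its norm, which makes the dissection of [zetaV] explicit. *)
Lemma zetaV_delta :
  V3 delta * zetaV = q * E 9 ^+ 3 * (V3 E1cube0 ^+ 2 + 3 * q * E 9 ^+ 3 * V3 E1cube0
      + 9 * q ^+ 2 * E 9 ^+ 6).
Proof.
rewrite V3delta -zetaV_E1 E1_cube; ring.
Qed.

Lemma sec0_zetaV : sec 0 zetaV = 9 * Tinv.
Proof.
apply: (mulrI delta_unit); rewrite -sec_V3M // zetaV_delta.
transitivity (sec 0 (V3 (9 * q * E 3 ^+ 9) + q * V3 (E 3 ^+ 3 * E1cube0 ^+ 2)
   + q * (q * V3 (3 * E 3 ^+ 6 * E1cube0)))).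
  congr (sec 0 _); rewrite !V3simp V3E //; ring.
rewrite !(raddfD (sec 0)) /= !(sec0qM, sec2qM) !sec_V3 //=.
transitivity (9 * (Tinv * delta)); last by ring.
rewrite Tinv_delta; ring.
Qed.

Lemma sec0_zetaV2 : sec 0 (zetaV ^+ 2) = 6 * Tinv + 243 * Tinv ^+ 2.
Proof.
apply: (mulrI (unitrX 2 delta_unit)).
rewrite -sec_V3M // V3X -exprMn zetaV_delta.
transitivity (sec 0 (V3 (6 * q * E 3 ^+ 9 * E1cube0 ^+ 3 + 81 * q ^+ 2 * E 3 ^+ 18)
   + q * V3 (27 * q * E 3 ^+ 12 * E1cube0 ^+ 2)
   + q * (q * V3 (E 3 ^+ 6 * E1cube0 ^+ 4 + 54 * q * E 3 ^+ 15 * E1cube0)))).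
  congr (sec 0 _); rewrite !V3simp V3E //; ring.
rewrite !(raddfD (sec 0)) /= !(sec0qM, sec2qM, sec1qM) !sec_V3 //=.
transitivity (6 * delta * (Tinv * delta) + 243 * (Tinv * delta) ^+ 2); last by ring.
rewrite Tinv_delta /delta; ring.
Qed.

(** A row of the matrix [M] is handled as a polynomial in [Tinv], so that the row
    recurrence becomes a polynomial identity. *)
Definition evT (p : {poly int}) : fps int := (map_poly intr p).[Tinv].

Lemma evTD p r : evT (p + r) = evT p + evT r.
Proof. by rewrite /evT rmorphD hornerD. Qed.

Lemma evTM p r : evT (p * r) = evT p * evT r.
Proof. by rewrite /evT rmorphM hornerM. Qed.

Lemma evTnat n : evT n%:R = n%:R.
Proof. by rewrite /evT rmorph_nat hornerMn hornerC. Qed.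

Lemma evTX : evT 'X = Tinv.
Proof. by rewrite /evT map_polyX hornerX. Qed.

Lemma evTE n (p : {poly int}) : (size p <= n)%N -> evT p = \sum_(0 <= j < n) Tinv ^+ j *~ p`_j.
Proof.
move=> le; rewrite /evT (horner_coef_wide _ (leq_trans (size_poly _ _) le)) big_mkord.
by apply: eq_bigr => j _; rewrite coef_map /= mulrzl.
Qed.

(** By the cubic equation, with scalars [V3 Tinv] taken out, the rows satisfy a
    recurrence of order three. The last clause says that the entry [j]
    of row [i] vanishes when [3 j < i], since [zetaV ^ i] has order [i]; it is what
    makes the index shift [i + j - 1] in [A] and [B] lose nothing. *)
Lemma row_exists i : exists p : {poly int},
  [/\ (size p <= i.+1)%N, sec 0 (zetaV ^+ i) = evT p
    & forall j, (3 * j < i)%N -> p`_j = 0].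
Proof.
have sizeMn (p : {poly int}) n k : (size p <= k)%N -> (size (n%:R * p)%R <= k)%N.
  by move=> le; rewrite -[n%:R]polyC_natr mul_polyC (leq_trans (size_scale_leq _ _)).
have sizeD (p r : {poly int}) k : (size p <= k)%N -> (size r <= k)%N -> (size (p + r)%R <= k)%N.
  by move=> le1 le2; rewrite (leq_trans (size_polyD _ _)) // geq_max le1.
have coefMn0 (p : {poly int}) n j : p`_j = 0 -> (n%:R * p)`_j = 0.
  by move=> e; rewrite mulr_natl coefMn e mul0rn.
elim/ltn_ind: i => -[|[|[|i]]] IH.
- exists 1; split=> //; first by rewrite size_poly1.
  by rewrite expr0 sec_one // (evTnat 1).
- exists (9%:R * 'X); split.
  + by apply: sizeMn; rewrite size_polyX.
  + by rewrite expr1 sec0_zetaV evTM evTX evTnat.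
  + by case=> // _; rewrite coefMn0 // coefX.
- exists (6%:R * 'X + 243%:R * ('X * 'X)); split.
  + by apply: sizeD; apply: sizeMn; rewrite ?size_polyX // -expr2 size_polyXn.
  + by rewrite sec0_zetaV2 evTD !evTM evTX !evTnat expr2.
  + by case=> [_|j]; [rewrite coefD !coefMn0 ?coefX // coefXM | lia].
have [p2 [s2 e2 v2]] := IH i.+2 (ltnSn _).
have [p1 [s1 e1 v1]] := IH i.+1 (leqnSn _).
have [p0 [s0 e0 v0]] := IH i (leqW (leqnSn _)).
exists ('X * (27%:R * p2 + 9%:R * p1 + p0)); split.
- rewrite (leq_trans (size_polyMleq _ _)) // size_polyX /=.
  rewrite ltnS.
  apply: (sizeD _ _ _); [apply: (sizeD _ _ _); apply: (sizeMn _ _ _)|]; first exact: s2.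
    by apply: leq_trans s1 _.
  by apply: leq_trans s0 _; rewrite ltnS; lia.
- have -> : zetaV ^+ i.+3 =
      V3 Tinv * (27%:R * zetaV ^+ i.+2 + 9%:R * zetaV ^+ i.+1 + zetaV ^+ i).
    by rewrite -addn3 exprD zetaV_cubic !exprSr; ring.
  rewrite sec_V3M // !(raddfD (sec 0)) /= !sec_natM e2 e1 e0.
  by rewrite evTM !evTD !evTM evTX !evTnat.
- case=> [|j] lt; first by rewrite coefXM.
  by rewrite coefXM /= !coefD !coefMn0 ?v2 ?v1 ?v0 ?addr0 //; lia.
Qed.

Lemma H3E f : H3 f = V3 (sec 0 f).
Proof.
by apply: fpsP => n /=; case: ifP => // /divnK; rewrite addn0 mulnC => ->.
Qed.

Lemma M_rowP i : (0 < i)%N -> M_row i (M i) /\ forall j, (3 * j < i)%N -> M i j = 0.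
Proof.
move=> i0; have [p [sp e v]] := row_exists i.
have row : M_row i (fun j => p`_j).
  split=> [j|].
    rewrite negb_and -!ltnNge ltnS leqn0 => /orP[/eqP ->|lt]; first by rewrite v.
    by rewrite nth_default // (leq_trans sp).
  rewrite H3E e (evTE sp) big_ltn // v // mulr0z add0r (raddf_sum V3).
  by apply: eq_bigr => j _; rewrite raddfMz /= rmorphXn /= TVE.
have -> : M i = (fun j => p`_j).
  by apply: (@M_row_uniq i) => //; rewrite /M; apply: (xgetPex _ (ex_intro _ _ row)).
by [].
Qed.

Lemma M_gt i j : (0 < i)%N -> (i < j)%N -> M i j = 0.
Proof. by move=> i0 lt; case: (M_rowP i0) => -[-> //]; rewrite negb_and -!ltnNge lt orbT. Qed.

Lemma sec0_zetaVX i : (0 < i)%N ->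
  sec 0 (zetaV ^+ i) = \sum_(1 <= j < i.+1) Tinv ^+ j *~ M i j.
Proof.
move=> /M_rowP[[_ e] _]; apply: V3_inj; rewrite -H3E e raddf_sum.
by apply: eq_bigr => j _; rewrite raddfMz /= rmorphXn /= TVE.
Qed.

(** The expansion of [zetaV ^ i] with the scalar [V3 rho ^ (3 i)] moved out of the
    dissection. *)
Lemma sec0_qrho i : (0 < i)%N -> rho ^+ (3 * i) * sec 0 (q ^+ i * rho ^+ (3 * i)) =
  \sum_(1 <= j < i.+1) (q ^+ j * rho ^+ (12 * j)) *~ M i j.
Proof.
move=> i0; rewrite -sec_V3M // V3X.
rewrite (_ : _ * _ = zetaV ^+ i).
  rewrite sec0_zetaVX //; apply: eq_bigr => j _.
  by rewrite /Tinv exprMn exprM.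
rewrite zetaVE; move: q rho (V3 rho) => a r v.
by rewrite exprMn -exprM exprMn [LHS]mulrC -mulrA.
Qed.

(** * The recursion for the coefficient vectors *)

(** The summands of the theorem, with [E 3 / E 1] written [rho]. *)
Definition gterm (i : nat) : fps int := q ^+ (i - 1) * rho ^+ (3 * (4 * i - 2)).

(** The analogous summands one step earlier, where [zetaV] occurs to the power
    [4 i - 3] and a factor [V3 rho ^ (-3)] is left over. *)
Definition hterm (i : nat) : fps int :=
  q ^+ (i - 1) * rho ^+ (3 * (4 * i - 3)) / V3 rho ^+ 3.

Lemma qXM_inj i : injective ( *%R (q ^+ i)).
Proof.
elim: i => [|i IH] f g; first by rewrite !mul1r.
by rewrite exprS -!mulrA => /qM_inj /IH.
Qed.

Lemma rhoX_unit k : rho ^+ k \is a GRing.unit.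
Proof. exact: unitrX rho_unit. Qed.

(** Row [a] of [M] has no entry before [i], so its expansion can be divided by
    [q ^ i rho ^ (12 i - 6)]; what remains is a combination of the [gterm j]. *)
Lemma M_row_shift a i N : (3 * (i - 1) < a)%N -> (0 < i)%N -> (a < N + i)%N ->
  \sum_(1 <= l < a.+1) (q ^+ l * rho ^+ (12 * l)) *~ M a l =
  q ^+ i * (rho ^+ (3 * (4 * i - 2)) * \sum_(1 <= j < N.+1) gterm j *~ M a (i + j - 1)).
Proof.
move=> lta i0 leN; have a0 : (0 < a)%N by lia.
have [_ Mlow] := M_rowP a0.
transitivity (\sum_(1 <= l < N + i) (q ^+ l * rho ^+ (12 * l)) *~ M a l).
  rewrite [RHS](big_cat_nat _ (n := a.+1)) //=.
  rewrite [X in _ + X]big_nat [X in _ + X]big1 ?addr0 // => l /andP[ltl _].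
  by rewrite M_gt // mulr0z.
rewrite (big_cat_nat _ (n := i)) //=; last lia.
rewrite big_nat big1 ?add0r; last first.
  by move=> l /andP[l0 lti]; rewrite Mlow ?mulr0z //; lia.
rewrite -[X in \sum_(X <= _ < _) _](subnKC i0) big_addn.
rewrite (_ : N + i - (i - 1) = N.+1)%N; last lia.
rewrite mulrA mulr_sumr !big_nat; apply: eq_bigr => j /andP[j0 _].
rewrite (_ : i + j - 1 = j + (i - 1))%N; last lia.
rewrite mulrzAr; congr (_ *~ _); rewrite /gterm.
move: rho => r; rewrite mulrACA -!exprD; congr (_ ^+ _ * _ ^+ _); lia.
Qed.

(** Up to the scalar [V3 (q ^ (i - 1))], [q ^ 2 * gterm i] is
    [q ^ (4 i - 2) rho ^ (3 (4 i - 2))], to which row [4 i - 2] applies. *)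
Lemma sec1_gterm i N : (0 < i)%N -> (4 * i - 2 < N + i)%N ->
  sec 1 (gterm i) = \sum_(1 <= j < N.+1) gterm j *~ A i j.
Proof.
move=> i0 leN; apply: (mulrI (rhoX_unit (3 * (4 * i - 2)))); apply: (@qXM_inj i).
rewrite -M_row_shift //; last lia.
rewrite -sec0_qrho; last lia.
have -> : q ^+ (4 * i - 2) * rho ^+ (3 * (4 * i - 2)) = V3 (q ^+ (i - 1)) * (q * (q * gterm i)).
  rewrite V3X V3q -exprM /gterm; move: rho => r; rewrite !mulrA -!exprSr -exprD.
  by congr (_ ^+ _ * _); lia.
rewrite sec_V3M // sec0qM sec2qM mulrCA; congr (_ * _).
by rewrite mulrA -exprSr; congr (_ ^+ _ * _); lia.
Qed.

(** Here the scalar is [V3 (q ^ (i - 1) rho ^ 3)] and the row is [4 i - 3]. *)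
Lemma sec2_hterm i N : (0 < i)%N -> (4 * i - 3 < N + i)%N ->
  sec 2 (hterm i) = \sum_(1 <= j < N.+1) gterm j *~ B i j.
Proof.
move=> i0 leN; apply: (mulrI (rhoX_unit (3 * (4 * i - 2)))); apply: (@qXM_inj i).
rewrite -M_row_shift //; last lia.
rewrite -sec0_qrho; last lia.
have -> : q ^+ (4 * i - 3) * rho ^+ (3 * (4 * i - 3)) =
    V3 (q ^+ (i - 1) * rho ^+ 3) * (q * hterm i).
  have u := unitrX 3 (V3unit rho_unit).
  rewrite V3M !V3X V3q -exprM /hterm; move: rho (V3 rho) u => r v u.
  rewrite mulrACA [v ^+ 3 * _]mulrC divrK // mulrA -!exprSr -exprD.
  by congr (_ ^+ _ * _); lia.
rewrite sec_V3M // sec0qM.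
have -> : (3 * (4 * i - 2) = 3 * (4 * i - 3) + 3)%N by lia.
have -> : q ^+ i = q ^+ (i - 1) * q by rewrite -exprSr; congr (_ ^+ _); lia.
rewrite exprD; ring.
Qed.

(** The generating function of [RD 3 3 27]; [rho] and its threefold image by [V3]
    account for [E 3 / E 1] and [E 81 / E 27]. *)
Definition RD3gf : fps int := rho ^+ 3 / V3 (V3 (V3 rho)) ^+ 3.

Lemma sec2_RD3gf : sec 2 RD3gf = 9 * (rho ^+ 9 / V3 (V3 rho) ^+ 3).
Proof.
have u3 : V3 (V3 (V3 rho)) \is a GRing.unit by rewrite !V3unit ?rho_unit.
have u2 : V3 (V3 rho) \is a GRing.unit by rewrite !V3unit ?rho_unit.
have zE : zetaV = V3 (rho ^+ 3 * V3 (V3 rho) ^+ 3) * (q * RD3gf).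
  rewrite zetaVE V3M !V3X /RD3gf; move: rho (V3 rho) (V3 (V3 _)) u3 => r v w u.
  transitivity (q * (r * v) ^+ 3 * (w ^+ 3 / w ^+ 3)); last by ring.
  by rewrite divrr ?mulr1 ?unitrX.
have := sec0_zetaV; rewrite zE sec_V3M // sec0qM /Tinv => e.
apply: (mulrI (unitrX 3 u2)); apply: (mulrI (rhoX_unit 3)); apply: qM_inj.
move: e; move: rho (V3 (V3 rho)) u2 => r v u.
set s := sec 2 RD3gf => e.
transitivity (r ^+ 3 * v ^+ 3 * (q * s)); first by ring.
rewrite e; transitivity (9 * (q * r ^+ 12) * (v ^+ 3 / v ^+ 3)); last by ring.
by rewrite divrr ?mulr1 ?unitrX.
Qed.

Lemma sec0_zetaV3 : sec 0 (zetaV ^+ 3) = Tinv + 243 * Tinv ^+ 2 + 6561 * Tinv ^+ 3.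
Proof.
rewrite zetaV_cubic sec_V3M // !(raddfD (sec 0)) /= !sec_natM sec0_zetaV sec0_zetaV2 sec_one //=.
ring.
Qed.

Lemma sum_hterm_y2 : \sum_(1 <= i < 4) hterm i *~ y 2 i =
  3 ^+ 2 * (rho ^+ 3 / V3 rho ^+ 3) + (3 ^+ 7 * (q * rho ^+ 15 / V3 rho ^+ 3)
   + 3 ^+ 10 * (q ^+ 2 * rho ^+ 27 / V3 rho ^+ 3)).
Proof.
have mul3X i (c : int) k f : c = 3 ^+ k -> hterm i = f -> hterm i *~ c = 3 ^+ k * f.
  by move=> -> ->; rewrite -mulrzl rmorphXn.
rewrite (big_ltn (isT : 1 < 4)%N) (big_ltn (isT : 2 < 4)%N) big_nat1.
congr (_ + (_ + _)); apply: mul3X; [by []| |by []| |by []|]; rewrite /hterm ?mul1r ?expr1 //.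
Qed.

Lemma sec02_RD3gf : sec 0 (sec 2 RD3gf) = \sum_(1 <= i < 4) hterm i *~ y 2 i.
Proof.
have u2 : V3 (V3 rho) \is a GRing.unit by rewrite !V3unit ?rho_unit.
have u1 : V3 rho \is a GRing.unit by rewrite !V3unit ?rho_unit.
set G := rho ^+ 9 / V3 (V3 rho) ^+ 3.
have zE : zetaV ^+ 3 = V3 (q * rho ^+ 9 * V3 rho ^+ 3) * G.
  rewrite zetaVE /G; move: rho u2 => r; rewrite !(V3X, V3M, V3q).
  move: (V3 r) (V3 (V3 _)) => v w u.
  transitivity ((q * (r * v) ^+ 3) ^+ 3 * (w ^+ 3 / w ^+ 3)); last by ring.
  by rewrite divrr ?mulr1 ?unitrX.
have := sec0_zetaV3; rewrite zE sec_V3M // /Tinv => e.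
rewrite sec2_RD3gf -/G mulr_natl raddfMn /= -mulr_natl.
apply: (mulrI (unitrX 3 u1)); apply: (mulrI (rhoX_unit 9)); apply: qM_inj.
transitivity (9 * (q * rho ^+ 9 * V3 rho ^+ 3 * sec 0 G)); first by ring.
rewrite e sum_hterm_y2.
move: rho (V3 rho) u1 => r v u.
transitivity (q * (r ^+ 9 * (3 ^+ 2 * r ^+ 3 + 3 ^+ 7 * (q * r ^+ 15)
   + 3 ^+ 10 * (q ^+ 2 * r ^+ 27)) * (v ^+ 3 / v ^+ 3))); last by ring.
rewrite divrr ?unitrX // mulr1; ring.
Qed.

(** The infinite sum in [vecmx] is an honest one only for finitely supported [v]. *)
Lemma vecmx_finite L (v : nat -> int) C j : (forall i, (L < i)%N -> v i = 0) ->
  vecmx v C j = \sum_(1 <= i < L.+1) v i * C i j.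
Proof.
move=> v0; rewrite /vecmx (fsbigE (index_iota 1 L.+1)) ?iota_uniq //.
- rewrite big_seq_cond [RHS]big_seq; apply: eq_bigl => i.
  by rewrite mem_index_iota andb_idr // => /andP[i1 _]; rewrite inE.
- by move=> i /=; rewrite mem_index_iota => /andP[].
- move=> i /= i1; rewrite mem_index_iota i1 /= ltnS -ltnNge => lt.
  by rewrite v0 // mul0r.
Qed.

Lemma sec_sum r (u : nat -> fps int) (v : nat -> int) C L N :
  (forall i, (L < i)%N -> v i = 0) ->
  (forall i, (1 <= i <= L)%N -> sec r (u i) = \sum_(1 <= j < N.+1) gterm j *~ C i j) ->
  sec r (\sum_(1 <= i < L.+1) u i *~ v i) = \sum_(1 <= j < N.+1) gterm j *~ vecmx v C j.
Proof.
move=> v0 uE; rewrite raddf_sum.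
transitivity (\sum_(1 <= i < L.+1) \sum_(1 <= j < N.+1) gterm j *~ (v i * C i j)).
  rewrite !big_nat; apply: eq_bigr => i lti.
  rewrite raddfMz /= uE // mulrz_suml; apply: eq_bigr => j _.
  by rewrite -mulrzA mulrC.
rewrite exchange_big; apply: eq_bigr => j _.
by rewrite (vecmx_finite _ _ v0) mulrz_sumr.
Qed.

Lemma exp3_odd d : exists t, (3 ^ d = t.*2.+1)%N.
Proof. by exists (3 ^ d)./2; rewrite -[LHS]odd_double_half oddX orbT. Qed.

(** [chain d] is the left-hand side of the theorem for [k = d + 3]. The first three
    residues 2, 0, 2 and then always 1 are the successive base 3 digits of the
    progressions: [27 n + 20 = 3 (3 (3 n + 2)) + 2]. *)
Fixpoint chain (d : nat) : fps int :=
  if d is d'.+1 then sec 1 (chain d') else sec 2 (sec 0 (sec 2 RD3gf)).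

(** The support bound must be carried along with the identity: it makes the vector
    finitely supported, and [L] becomes [3 L - 1] at each step. *)
Lemma chainP d (L := ((3 ^ d * 13 + 1) %/ 2)%N) :
  chain d = \sum_(1 <= i < L.+1) gterm i *~ y (d + 3) i /\
  forall i, (L < i)%N -> y (d + 3) i = 0.
Proof.
rewrite {}/L; elim: d => [|d [IH v0]].
  have v0 i : (3 < i)%N -> y 2 i = 0 by move=> lt; rewrite /= /vec nth_default.
  split.
    rewrite /= sec02_RD3gf; apply: sec_sum => // i /andP[i1 i3].
    by apply: sec2_hterm => //; lia.
  move=> j ltj; rewrite -[LHS]/(vecmx (y 2) B j) (vecmx_finite _ _ v0) big_nat big1 //.
  move=> i /andP[i1 i3].
  by rewrite /B M_gt ?mulr0; lia.
have [t tE] := exp3_odd d.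
have yS : y (d.+1 + 3) = vecmx (y (d + 3)) A by rewrite addSn !addn3.
have LE : ((3 ^ d.+1 * 13 + 1) %/ 2 = 3 * ((3 ^ d * 13 + 1) %/ 2) - 1)%N.
  by rewrite expnS tE; lia.
rewrite yS LE; set L := (_ %/ 2)%N in IH v0 *; split.
  rewrite /= IH; apply: sec_sum => // i /andP[i1 i3].
  by apply: sec1_gterm => //; lia.
move=> j ltj; rewrite (vecmx_finite _ _ v0) big_nat big1 // => i /andP[i1 i3].
by rewrite /A M_gt ?mulr0; lia.
Qed.

Lemma fcoef_chain d n :
  fcoef (chain d) n = fcoef RD3gf (3 ^ (d + 3) * n + (3 ^ (d + 3) + 13) %/ 2).
Proof.
elim: d n => [|d IH] n; first by congr (fcoef RD3gf _); rewrite add0n -[(3 ^ 3)%N]/27%N; lia.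
rewrite -[LHS]/(fcoef (chain d) (3 * n + 1)) IH; congr (fcoef RD3gf _).
have [t tE] := exp3_odd (d + 3).
rewrite addSn expnS tE; nia.
Qed.

Lemma RD3gfE : RD3gf * (E 1 * E 81) ^+ 3 = (E 3 * E 27) ^+ 3.
Proof.
have V9rho : V3 (V3 (V3 rho)) = E 81 / E 27.
  have V3div m n : (0 < m)%N -> (0 < n)%N -> V3 (E m / E n) = E (3 * m) / E (3 * n).
    by move=> m0 n0; rewrite V3M (rmorphV V3) ?E_unit //= !V3E.
  by rewrite V3rho !V3div.
rewrite /RD3gf V9rho /rho; move: (E 1) (E 3) (E 27) (E 81) (E_unit 1) (E_unit 27) (E_unit 81).
move=> a b c d ua uc ud; rewrite -exprVn invrM ?unitrV // invrK -!exprMn; congr (_ ^+ 3).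
transitivity (b * c * (a / a) * (d / d)); first by ring.
by rewrite !divrr ?mulr1.
Qed.

(** * The generating function of RD *)

Lemma prod_multiples l n (G : nat -> fps int) : (0 < l)%N ->
  \prod_(1 <= m < n.+1) (if (l %| m)%N then G m else 1) =
  \prod_(1 <= j < (n %/ l).+1) G (j * l)%N.
Proof.
move=> l0; elim: n => [|n IH]; first by rewrite div0n !big_geq.
rewrite big_nat_recr //= IH divnS //.
case: ifP => d; last by rewrite add0n mulr1.
rewrite add1n [RHS]big_nat_recr //=; congr (_ * G _).
by have /divnK := d; rewrite divnS // d add1n.
Qed.

Lemma eqm_prod_multiples l s n : (0 < l)%N -> (0 < s)%N ->
  eqm n.+1 (\prod_(1 <= m < n.+1) (if (l %| m)%N then 1 - q ^+ (m * s) else 1)) (E (l * s)).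
Proof.
move=> l0 s0; rewrite prod_multiples //.
have -> : \prod_(1 <= j < (n %/ l).+1) (1 - q ^+ (j * l * s)) = euler (n %/ l) (l * s).
  by apply: eq_bigr => j _; rewrite mulnA.
apply: eqm_euler; first by rewrite muln_gt0 l0.
by rewrite mulnA (leq_trans _ (leq_pmulr _ s0)) // ltn_ceil.
Qed.

Lemma geometric_series n m t : (0 < m)%N ->
  eqm n.+1 ((\sum_(j < n.+1 | (j < t)%N) q ^+ (m * j)) * (1 - q ^+ m)) (1 - q ^+ (m * t)).
Proof.
move=> m0.
have tel k : (\sum_(j < k) q ^+ (m * j)) * (1 - q ^+ m) = 1 - q ^+ (m * k).
  elim: k => [|k IH]; first by rewrite big_ord0 muln0 mul0r subrr.
  by rewrite big_ord_recr /= mulrDl IH mulnS exprD mulrBr mulr1 addrA subrK [q ^+ m * _]mulrC.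
have [le|lt] := leqP t n.+1.
  rewrite [X in X * _](_ : _ = \sum_(j < t) q ^+ (m * j)); first by rewrite tel.
  by rewrite (big_ord_widen n.+1 (fun j => q ^+ (m * j))).
rewrite [X in X * _](_ : _ = \sum_(j < n.+1) q ^+ (m * j)); last first.
  by apply: eq_bigl => j; have := ltn_ord j; lia.
rewrite tel; apply: eqm_trans (_ : eqm n.+1 _ 1) _; first by apply: eqm_1BqX; nia.
by apply: eqm_sym; apply: eqm_1BqX; nia.
Qed.

(** One color of the part [m], truncated to multiplicities at most [n] as in the
    definition of [RD]; a part divisible by [l] may only occur 0 times. *)
Definition part_gf (l t n m : nat) : fps int :=
  \sum_(j < n.+1 | (((l %| m) ==> (j == 0 :> nat)) && (j < t))%N) q ^+ (m * j).

(** Both sides carry a factor for the multiples of [l], so that the product over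
    all [m] yields complete products [E r] instead of products over the [m] prime
    to [l]. *)
Lemma eqm_part_gf l t n m : (0 < m)%N -> (0 < t)%N ->
  eqm n.+1 (part_gf l t n m * ((1 - q ^+ m) * (if (l %| m)%N then 1 - q ^+ (m * t) else 1)))
    ((1 - q ^+ (m * t)) * (if (l %| m)%N then 1 - q ^+ m else 1)).
Proof.
move=> m0 t0; rewrite /part_gf; case: ifP => d /=.
  rewrite (big_pred1 ord0) => [|j]; first by rewrite muln0 expr0 mul1r mulrC.
  by case: j => [[|j] lt] /=.
by rewrite !mulr1; apply: geometric_series.
Qed.

Lemma RD_coef k l t n :
  (RD k l t n)%:Z = fcoef ((\prod_(1 <= m < n.+1) part_gf l t n m) ^+ k) n.
Proof.
have -> : (\prod_(1 <= m < n.+1) part_gf l t n m) ^+ k =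
    \prod_(p : 'I_n * 'I_k) part_gf l t n p.1.+1.
  rewrite -(pair_bigA _ (fun (i : 'I_n) (c : 'I_k) => part_gf l t n i.+1)) /=.
  rewrite big_add1 big_mkord -prodrXl; apply: eq_bigr => i _.
  by rewrite prodr_const card_ord.
rewrite /part_gf bigA_distr_big_dep fcoef_sum /RD -sum1_card.
rewrite big_mkcond [RHS]big_mkcond.
rewrite (big_morph Posz PoszD (erefl _)).
apply: eq_bigr => f _.
have qX m : fcoef (q ^+ m) n = (m == n)%:R.
  rewrite -[q ^+ m]mulr1 fcoefqXM fcoef1 subn_eq0 eqn_leq.
  by case: (m <= n)%N.
rewrite inE prodrXr qX.
rewrite [f \in family _](_ : _ =
    [forall p : 'I_n * 'I_k, (l %| p.1.+1)%N ==> (f p == 0%N :> nat)]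
    && [forall p, (f p < t)%N]); last first.
  apply/familyP/andP => [h|[/forallP h1 /forallP h2] p].
    by split; apply/forallP => p; have /andP[] := h p.
  by apply/andP; split; [apply: h1 | apply: h2].
rewrite -[X in (X == n)%:R]/(\sum_(p : 'I_n * 'I_k) p.1.+1 * f p)%N.
by case: (_ == n) => /=; case: (_ && _).
Qed.

Lemma RD_gf k l t : (0 < l)%N -> (0 < t)%N ->
  Fps (fun n => (RD k l t n)%:Z) = (E l * E t / (E 1 * E (l * t))) ^+ k.
Proof.
move=> l0 t0; apply: fpsP => N; rewrite [LHS]RD_coef.
set Q := \prod_(1 <= m < N.+1) part_gf l t N m.
pose D s := \prod_(1 <= m < N.+1) (if (l %| m)%N then 1 - q ^+ (m * s) else 1).
have De s : (0 < s)%N -> eqm N.+1 (D s) (E (l * s)) by move=> s0; apply: eqm_prod_multiples.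
have Qe : eqm N.+1 (Q * (E 1 * E (l * t))) (E t * E l).
  apply: eqm_trans (_ : eqm N.+1 _ (Q * (euler N 1 * D t))) _.
    apply: eqmM => //; apply: eqmM; apply: eqm_sym; last exact: De.
    by apply: eqm_euler; rewrite ?muln1.
  apply: eqm_trans (_ : eqm N.+1 _ (euler N t * D 1)) _; last first.
    apply: eqmM; last by rewrite -[l in E l]muln1; apply: De.
    by apply: eqm_euler => //; rewrite leq_pmulr.
  rewrite /Q /euler /D -!big_split /= !big_nat; apply: eqm_prod => m /andP[m0 _].
  by rewrite muln1; apply: eqm_part_gf.
have u : E 1 * E (l * t) \is a GRing.unit by rewrite unitrM !E_unit.
have {Qe}Qe : eqm N.+1 Q (E l * E t / (E 1 * E (l * t))).
  by rewrite -[Q](mulrK u) [E l * _]mulrC; apply: eqmM.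
by apply: (eqmX k Qe).
Qed.


Unset Implicit Arguments.

Theorem theorem1p5 (k : nat) (hk : (3 <= k)%N) :
  Fps (fun n : nat =>
    (RD 3 3 27 (3 ^ k * n + (3 ^ k + 13) %/ 2)%N)%:Z) =
  \sum_(1 <= i < ((3 ^ (k - 3) * 13 + 1) %/ 2).+1)
    (q ^+ (i - 1) *
      (E 3 ^+ (3 * (4 * i - 2)) / E 1 ^+ (3 * (4 * i - 2)))) *~ y k i.
Proof.
have [sumE _] := chainP (k - 3).
rewrite subnK // in sumE.
transitivity (chain (k - 3)).
  apply: fpsP => n; rewrite fcoef_chain subnK //.
  have := @RD_gf 3 3 27 isT isT; rewrite -[(3 * 27)%N]/81%N => gf.
  have -> : RD3gf = Fps (fun n => (RD 3 3 27 n)%:Z).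
    rewrite gf; apply: (mulIr (unitrX 3 (_ : E 1 * E 81 \is a GRing.unit))).
      by rewrite unitrM !E_unit.
    by rewrite RD3gfE -exprMn divrK // unitrM !E_unit.
  by [].
rewrite sumE; apply: eq_bigr => i _; rewrite /gterm /rho.
by move: (E 3) (E 1) => a b; rewrite exprMn exprVn.
Qed.
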